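(* For every strip $\lambda/\mu$ with $n$ cells, there exists a cyclic descent map, specified for $T\in\mathrm{SYT}(\lambda/\mu)$ by letting $n\in\mathrm{cDes}(T)$ if and only if either $n$ is strictly north of $1$ in $T$, or $1$ and $n$ are in the same vertical component of $T$; equivalently, if and only if $n-1\in\mathrm{Des}(pT)$, where $p$ is the promotion operator.
   Context: Let $[n]=\{1,\dots,n\}$. Tableaux are drawn in English notation (row 1 on top). For a skew shape $\lambda/\mu$ with $n$ cells, $\mathrm{SYT}(\lambda/\mu)$ is the set of standard Young tableaux of that shape; $\mathrm{Des}(T)=\{i\in[n-1]: i+1\text{ is in a lower row than } i\text{ in }T\}$. A strip is a skew shape all of whose connected components have either only one row or only one column. A vertical component is a connected component consisting of a single column (with at least two cells). ''$n$ is strictly north of $1$'' means that the row containing $n$ is strictly above the row containing $1$. Promotion is $pT=\widetilde{\mathrm{jdt}}(-1+T)$. Here, for an integer $a$, $a+T$ is the filling obtained by adding $a$ modulo $n$ (with values in $[n]$) to each entry of $T$, and $\widetilde{\mathrm{jdt}}(a+T)$ is the standard tableau obtained from $T_0=a+T$ by repeating the following step until $T_0$ is standard: let $i$ be the minimal entry of $T_0$ such that the entries immediately above it and immediately to its left (those that exist) are not all smaller than $i$; switch $i$ with the larger of these entries. (For a strip, this simply sorts the entries within each component.) A cyclic descent map for $\lambda/\mu$ is a map $\mathrm{cDes}:\mathrm{SYT}(\lambda/\mu)\to 2^{[n]}$ such that (i) $\mathrm{cDes}(T)\cap[n-1]=\mathrm{Des}(T)$ for every $T$; and (ii) the multiset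 $\{\!\{\mathrm{cDes}(T):T\in\mathrm{SYT}(\lambda/\mu)\}\!\}$ is invariant under replacing each set $D$ by $1+D$ (adding $1$ modulo $n$ to each element). By (i), such a map is determined by specifying for which $T$ one has $n\in\mathrm{cDes}(T)$. *)

(* Defs.v *)
From HB Require Import structures.
From mathcomp Require Import all_boot fingroup perm zify.

Set Implicit Arguments.
Unset Strict Implicit.
Unset Printing Implicit Defensive.

(** ** Skew shapes *)

Definition is_partition (p : seq nat) : bool := sorted geq p && (0 \notin p).

Record skew_shape := SkewShape {
  outer : seq nat;
  inner : seq nat;
  outer_partition : is_partition outer;
  inner_partition : is_partition inner;
  inner_outer : forall i, nth 0 inner i <= nth 0 outer i
}.

(* Rows and columns are numbered from 0, row 0 being the top one; every cell
   lies in the bounding box of the outer partition. *)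
Record cell (s : skew_shape) := Cell {
  coords : 'I_(size (outer s)) * 'I_(nth 0 (outer s) 0);
  _ : nth 0 (inner s) coords.1 <= coords.2 < nth 0 (outer s) coords.1
}.
HB.instance Definition _ s := [isSub for @coords s].
HB.instance Definition _ s := [Countable of cell s by <:].
HB.instance Definition _ s := [Finite of cell s by <:].

Definition crow s (x : cell s) : nat := (coords x).1.
Definition ccol s (x : cell s) : nat := (coords x).2.

Definition ncells (s : skew_shape) : nat := #|{: cell s}|.

(** ** Connected components and strips *)

Definition left_of s (x y : cell s) : bool :=
  (crow x == crow y) && (ccol y == (ccol x).+1).
Definition above s (x y : cell s) : bool :=
  (ccol x == ccol y) && (crow y == (crow x).+1).

Definition adjacent s : rel (cell s) :=
  fun x y => [|| left_of x y, left_of y x, above x y | above y x].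

Definition component s (x : cell s) : {set cell s} :=
  [set y | connect (@adjacent s) x y].

Definition one_row s (C : {set cell s}) : bool :=
  [forall x in C, forall y in C, crow x == crow y].
Definition one_column s (C : {set cell s}) : bool :=
  [forall x in C, forall y in C, ccol x == ccol y].

Definition is_strip (s : skew_shape) : Prop :=
  forall x : cell s, one_row (component x) || one_column (component x).

Definition vertical s (C : {set cell s}) : bool :=
  one_column C && (2 <= #|C|).

(** ** Standard Young tableaux *)

(* [n] = {1, ..., n} is the set of nonzero elements of 'I_n.+1. *)
Definition range1 n : {set 'I_n.+1} := [set i : 'I_n.+1 | 0 < i].

Notation filling s := {ffun cell s -> 'I_(ncells s).+1}.

(* Injectivity forces each entry of [n] to be used exactly once, n being the
   number of cells. *)
Definition numbering s (F : filling s) : bool :=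
  injectiveb F && [forall x, F x \in range1 (ncells s)].

Definition rows_increasing s (F : filling s) : bool :=
  [forall x, forall y, (crow x == crow y) && (ccol x < ccol y) ==> (F x < F y)].
Definition columns_increasing s (F : filling s) : bool :=
  [forall x, forall y, (ccol x == ccol y) && (crow x < crow y) ==> (F x < F y)].

Definition standard s (F : filling s) : bool :=
  [&& numbering F, rows_increasing F & columns_increasing F].

Record SYT (s : skew_shape) := MkSYT {
  tableau :> filling s;
  tableau_standard : standard tableau
}.
HB.instance Definition _ s := [isSub for @tableau s].
HB.instance Definition _ s := [Countable of SYT s by <:].
HB.instance Definition _ s := [Finite of SYT s by <:].

Definition Des s (T : SYT s) : {set 'I_(ncells s).+1} :=
  [set i : 'I_(ncells s).+1 | (0 < i < ncells s) &&
    [exists x, exists y,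
       [&& T x == i, T y == i.+1 :> nat & crow x < crow y]]].

(** ** Addition modulo n, with values in [n] *)

Definition cyc_succ n (k : 'I_n.+1) : 'I_n.+1 :=
  inord (if k == n :> nat then 1 else k.+1).
Definition cyc_pred n (k : 'I_n.+1) : 'I_n.+1 :=
  inord (if k == 1 :> nat then n else k.-1).

(** ** Jeu de taquin and promotion *)

Definition above_or_left s (y x : cell s) : bool := above y x || left_of y x.

Definition bad s (F : filling s) (x : cell s) : bool :=
  ~~ [forall y, above_or_left y x ==> (F y < F x)].

(* x contains the minimal bad entry, and y the larger of the entries
   immediately above x and immediately to its left; in a numbering the entries
   are distinct, so there is at most one such pair. *)
Definition to_switch s (F : filling s) (x y : cell s) : bool :=
  [&& bad F x, [forall z, bad F z ==> (F x <= F z)],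
      above_or_left y x & [forall z, above_or_left z x ==> (F z <= F y)]].

Definition jdt_step s (F : filling s) : filling s :=
  if [pick p : cell s * cell s | to_switch F p.1 p.2] is Some p
  then [ffun z => F (tperm p.1 p.2 z)] else F.

Lemma nth_partition p i j :
  is_partition p -> i <= j -> nth 0 p j <= nth 0 p i.
Proof.
case/andP=> sp _ le_ij; have [lt_jp|le_pj] := ltnP j (size p); last first.
  by rewrite nth_default.
have := @sorted_leq_nth _ geq _ _ 0 p sp i j; apply=> //.
- by move=> a b c /= ba ac; exact: leq_trans ac ba.
- by move=> a /=.
- by rewrite inE (leq_ltn_trans le_ij).
Qed.

Lemma mk_cell s i j : nth 0 (inner s) i <= j < nth 0 (outer s) i ->
  exists x : cell s, crow x = i /\ ccol x = j.
Proof.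
move=> hij; have /andP[_ hj] := hij.
have hi : i < size (outer s).
  by rewrite ltnNge; apply/negP=> h; rewrite nth_default in hj.
have hj0 : j < nth 0 (outer s) 0.
  exact: leq_trans hj (nth_partition (outer_partition s) (leq0n i)).
by exists (@Cell s (Ordinal hi, Ordinal hj0) hij).
Qed.

Lemma cellP s (x : cell s) :
  nth 0 (inner s) (crow x) <= ccol x < nth 0 (outer s) (crow x).
Proof. exact: valP x. Qed.

Lemma cell_inj s (x y : cell s) : crow x = crow y -> ccol x = ccol y -> x = y.
Proof.
move=> hr hc; apply/val_inj; rewrite /= [coords x]surjective_pairing.
by rewrite [coords y]surjective_pairing; congr pair; apply/val_inj.
Qed.

Lemma not_bad_standard s (F : filling s) :
  numbering F -> (forall x, ~~ bad F x) -> standard F.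
Proof.
move=> nF good.
have ok y x : above_or_left y x -> F y < F x.
  by move: (good x); rewrite negbK => /forallP/(_ y)/implyP.
rewrite /standard nF /=; apply/andP; split.
- apply/forallP=> x; apply/forallP=> y; apply/implyP=> /andP[/eqP hr].
  have [d le_d] := ubnP (ccol y); elim: d => // d IH in y hr le_d *.
  rewrite leq_eqVlt => /orP[/eqP hxy|lt_xy].
    by apply: ok; rewrite /above_or_left /left_of hr hxy !eqxx orbT.
  have hz : nth 0 (inner s) (crow y) <= (ccol y).-1 < nth 0 (outer s) (crow y).
    have := cellP x; have := cellP y; rewrite hr => /andP[_ hy] /andP[hx _].
    apply/andP; split; last exact: leq_ltn_trans (leq_pred _) hy.
    apply: leq_trans hx _; case: (ccol y) lt_xy => // m.
    by rewrite !ltnS => /ltnW.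
  have [z [zr zc]] := mk_cell hz.
  have y0 : (ccol y).-1.+1 = ccol y by case: (ccol y) lt_xy.
  apply: (@ltn_trans (F z)).
    by apply: IH; rewrite ?zr ?zc // -ltnS y0.
  by apply: ok; rewrite /above_or_left /left_of zr zc y0 !eqxx orbT.
- apply/forallP=> x; apply/forallP=> y; apply/implyP=> /andP[/eqP hc].
  have [d le_d] := ubnP (crow y); elim: d => // d IH in y hc le_d *.
  rewrite leq_eqVlt => /orP[/eqP hxy|lt_xy].
    by apply: ok; rewrite /above_or_left /above hc hxy !eqxx.
  have le_x : crow x <= (crow y).-1.
    by case: (crow y) lt_xy => // m; rewrite !ltnS => /ltnW.
  have hz : nth 0 (inner s) (crow y).-1 <= ccol y < nth 0 (outer s) (crow y).-1.
    have := cellP x; have := cellP y; rewrite hc => /andP[_ hy] /andP[hx _].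
    apply/andP; split.
      exact: leq_trans (nth_partition (inner_partition s) le_x) hx.
    exact: leq_trans hy (nth_partition (outer_partition s) (leq_pred _)).
  have [z [zr zc]] := mk_cell hz.
  have y0 : (crow y).-1.+1 = crow y by case: (crow y) lt_xy.
  apply: (@ltn_trans (F z)).
    by apply: IH; rewrite ?zr ?zc // -ltnS y0.
  by apply: ok; rewrite /above_or_left /above zr zc y0 !eqxx.
Qed.

Lemma jdt_step_numbering s (F : filling s) :
  numbering F -> numbering (jdt_step F).
Proof.
rewrite /jdt_step; case: pickP => // p _ /andP[/injectiveP iF /forallP pF].
apply/andP; split; last by apply/forallP=> x; rewrite ffunE.
by apply/injectiveP=> x y; rewrite !ffunE => /iF /perm_inj.
Qed.

(* A switch moves the larger of two adjacent entries to the lower right. *)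
Definition jdt_weight s (F : filling s) : nat :=
  \sum_x F x * (crow x + ccol x).

Lemma jdt_step_weight s (F : filling s) : numbering F -> ~~ standard F ->
  jdt_weight F < jdt_weight (jdt_step F).
Proof.
move=> nF nsF; have /injectiveP iF := proj1 (andP nF).
have [x0 bx0] : exists x, bad F x.
  apply/existsP; apply: contraR nsF; rewrite negb_exists => /forallP.
  exact: not_bad_standard.
have [x bx minx] := arg_minnP (fun x => F x : nat) bx0.
have /forallPn[y1] := bx; rewrite negb_imply => /andP[ay1 gy1].
have [y ay maxy] :=
    @arg_maxnP _ y1 (fun z => above_or_left z x) (fun z => F z : nat) ay1.
have sw : to_switch F x y.
  rewrite /to_switch bx ay /=; apply/andP; split.
    by apply/forallP=> z; apply/implyP/minx.
  by apply/forallP=> z; apply/implyP/maxy.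
rewrite /jdt_step; case: pickP => [[u v] /= suv|/(_ (x, y))]; last by rewrite sw.
move: suv {x bx minx y1 ay1 gy1 y ay maxy sw} => /and4P[].
move: u v => x y bx _ ay /forallP maxy.
have lt_xy : F x < F y.
  have /forallPn[z] := bx; rewrite negb_imply -leqNgt => /andP[az le_xz].
  have := implyP (maxy z) az => le_zy; rewrite ltn_neqAle (leq_trans le_xz) //.
  rewrite andbT; apply/eqP => /val_inj/iF xy; move: ay.
  by rewrite xy /above_or_left /above /left_of !(ltn_eqF (ltnSn _)) !andbF.
have nyx : y != x by apply: contraTneq lt_xy => ->; rewrite ltnn.
have wx : crow x + ccol x = (crow y + ccol y).+1.
  by case/orP: ay => /andP[/eqP-> /eqP->]; rewrite ?addSn ?addnS.
rewrite /jdt_weight (bigD1 x) //= (bigD1 y) //=.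
rewrite [X in _ < X](bigD1 x) //= [X in _ < _ + X](bigD1 y) //=.
rewrite !ffunE tpermL tpermR !addnA.
rewrite [X in _ < _ + X](eq_bigr (fun z => F z * (crow z + ccol z))); last first.
  by move=> z /andP[zx zy]; rewrite ffunE tpermD // eq_sym.
rewrite ltn_add2r wx !mulnS.
by rewrite -!addnA [X in _ + X < _]addnC ltn_add2r.
Qed.

Lemma jdt_terminates s (F : filling s) :
  numbering F -> exists k, standard (iter k (@jdt_step s) F).
Proof.
move=> nF; pose M := \sum_(x : cell s) ncells s * (crow x + ccol x).
have leM (G : filling s) : jdt_weight G <= M.
  by apply: leq_sum => x _; rewrite leq_mul2r -ltnS ltn_ord orbT.
have [m] := ubnP (M - jdt_weight F); elim: m => // m IH in F nF *.
move=> lt_m; have [sF|nsF] := boolP (standard F); first by exists 0.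
have lt_w := jdt_step_weight nF nsF.
have [|k sk] := IH _ (jdt_step_numbering nF); last by exists k.+1; rewrite iterSr.
rewrite -ltnS; apply: leq_trans lt_m; rewrite ltnS.
by apply: ltn_sub2l => //; apply: leq_trans lt_w (leM _).
Qed.

Lemma jdt_standard s (F : filling s) (nF : numbering F) :
  standard (iter (ex_minn (jdt_terminates nF)) (@jdt_step s) F).
Proof. by case: ex_minnP. Qed.

(* ex_minn stops the iteration as soon as the filling is standard. *)
Definition jdt s (F : filling s) (nF : numbering F) : SYT s :=
  MkSYT (jdt_standard nF).

Definition pred_filling s (F : filling s) : filling s :=
  [ffun x => cyc_pred (F x)].

Lemma cyc_predE n (k : 'I_n.+1) :
  cyc_pred k = (if k == 1 :> nat then n else k.-1) :> nat.
Proof.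
rewrite /cyc_pred inordK //; case: ifP => // _.
by have := ltn_ord k; case: (k : nat) => //= m /ltnW.
Qed.

Lemma pred_filling_numbering s (F : filling s) :
  numbering F -> numbering (pred_filling F).
Proof.
case/andP=> /injectiveP iF /forallP pF.
have F0 x : 0 < F x by have := pF x; rewrite inE.
have n0 (x : cell s) : 0 < ncells s by rewrite -ltnS (leq_ltn_trans (F0 x)).
have ub (x : cell s) : F x <= ncells s by rewrite -ltnS.
apply/andP; split.
  apply/injectiveP=> x y /(congr1 val) /=; rewrite !ffunE !cyc_predE => e.
  apply/iF/val_inj => /=; move: e (F0 x) (F0 y) (ub x) (ub y).
  by do 2![case: eqP] => /=; lia.
apply/forallP=> x; rewrite inE ffunE cyc_predE.
by move: (F0 x) (n0 x); case: eqP => /=; lia.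
Qed.

Definition promotion s (T : SYT s) : SYT s :=
  jdt (pred_filling_numbering (proj1 (andP (tableau_standard T)))).

(** ** Cyclic descent maps *)

Definition rotate n (D : {set 'I_n.+1}) : {set 'I_n.+1} :=
  [set cyc_succ k | k in D].

Definition cyclic_descent_map s (cDes : SYT s -> {set 'I_(ncells s).+1}) : Prop :=
  [/\ forall T, cDes T \subset range1 (ncells s),
      forall T, cDes T :&: [set i | 0 < val i < ncells s] = Des T
    & perm_eq [seq rotate (cDes T) | T : SYT s] [seq cDes T | T : SYT s]].

Definition n_north_of_1 s (T : SYT s) : bool :=
  [exists x, exists y,
     [&& T x == ncells s :> nat, T y == 1 :> nat & crow x < crow y]].

Definition same_vertical_component s (T : SYT s) : bool :=
  [exists x, exists y,
     [&& T x == 1 :> nat, T y == ncells s :> nat,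
         y \in component x & vertical (component x)]].

(* Main.v *)
Require Import Defs.
From mathcomp Require Import all_boot fingroup perm zify.

Set Implicit Arguments.
Unset Strict Implicit.
Unset Printing Implicit Defensive.

(** A standard tableau of strip shape is determined by its word, the sequence
    of the components that contain 1, ..., n, because the cells of one
    component form a chain along which the entries increase. Whether i is a
    descent can be read off the word: distinct components of a skew shape
    occupy disjoint sets of rows, so the higher of two components is well
    defined ([crow_lt_component]), and inside one component there is a descent
    exactly when the component is vertical ([cdescent_standard]). The condition
    [cdescent] expresses this for two arbitrary cells and depends on their
    components only ([cdescent_component]).

    Jeu de taquin only switches adjacent cells, so it does not change the
    component that contains a given entry ([jdt_component_perm]). Hence
    promotion rotates the word cyclically by one place. Reading the word
    cyclically, as [cyclic_descents] does, gives a set that promotion rotates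
    ([rotate_promotion]), and at the place where n is followed by 1 it tests
    exactly the condition of the theorem ([cyclic_descents_max]). Since the
    word determines the tableau, promotion is injective, hence a bijection,
    and the multiset of the cyclic descent sets is invariant under rotation. *)

(** * Components of a skew shape *)

Lemma adjacent_sym s : symmetric (@adjacent s).
Proof.
move=> x y; rewrite /adjacent.
by case: (left_of x y) (left_of y x) (above x y) (above y x) => [] [] [] [].
Qed.

Lemma connect_adjacent_sym s : connect_sym (@adjacent s).
Proof. exact/sym_connect_sym/adjacent_sym. Qed.

Lemma component_eq s (x y : cell s) :
  connect (@adjacent s) x y -> component x = component y.
Proof.
move=> xy; apply/setP=> z.
by rewrite !inE (same_connect (@connect_adjacent_sym s) xy).
Qed.

(** A row of a skew shape is an interval. *)
Lemma connect_same_row s (x y : cell s) :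
  crow x = crow y -> connect (@adjacent s) x y.
Proof.
wlog le_xy : x y / ccol x <= ccol y.
  move=> H e; case: (leqP (ccol x) (ccol y)) => [h|/ltnW h]; first exact: H.
  by rewrite connect_adjacent_sym; apply: H.
elim: {y}(ccol y) {-2}y (erefl (ccol y)) le_xy => [|m IH] y hy.
  by rewrite hy leqn0 => /eqP hx hr; rewrite (cell_inj hr) ?connect0 // hx.
rewrite leq_eqVlt => /orP[/eqP hx hr|]; first by rewrite (cell_inj hr hx) connect0.
rewrite hy ltnS => le_xm hr.
have hz : nth 0 (inner s) (crow y) <= m < nth 0 (outer s) (crow y).
  by have := cellP x; have := cellP y; rewrite hr; lia.
have [z [zr zc]] := mk_cell hz.
apply: (@connect_trans _ _ z); first by apply: IH; rewrite ?zc ?zr.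
by apply: connect1; rewrite /adjacent /left_of zr zc hy !eqxx.
Qed.

(** A step between adjacent cells changes the row by at most one, so a
    component could only pass from above to below a cell by entering the row
    of that cell, and this row lies in a single component. *)
Lemma crow_lt_component s (x x' y : cell s) :
    connect (@adjacent s) x x' -> ~~ connect (@adjacent s) x y ->
  (crow x < crow y) = (crow x' < crow y).
Proof.
case/connectP=> p; elim: p x => [|z p IH] x /=; first by move=> _ ->.
case/andP=> xz pz ez nxy.
have nzy : ~~ connect (@adjacent s) z y.
  by apply: contra nxy; apply: connect_trans (connect1 xz).
rewrite -(IH _ pz ez nzy).
have neq_row (u : cell s) : ~~ connect (@adjacent s) u y -> crow u != crow y.
  by apply: contra => /eqP /connect_same_row.
have := neq_row _ nxy; have := neq_row _ nzy.
by move: xz; rewrite /adjacent /left_of /above; lia.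
Qed.

(** * Descents between cells of a strip *)

Lemma strip_cells s (x y : cell s) : is_strip s -> connect (@adjacent s) x y ->
  crow x = crow y \/ ccol x = ccol y /\ one_column (component x).
Proof.
move=> strip_s xy; have [xx yx] : x \in component x /\ y \in component x.
  by rewrite !inE connect0.
case/orP: (strip_s x) => [rx|cx].
  by left; apply/eqP; move/forall_inP: rx => /(_ x xx)/forall_inP/(_ y yx).
right; split=> //.
by apply/eqP; move/forall_inP: cx => /(_ x xx)/forall_inP/(_ y yx).
Qed.

Definition cdescent s (x y : cell s) : bool :=
  (crow x < crow y) || (y \in component x) && vertical (component x).

Lemma vertical_component s (x y : cell s) : is_strip s ->
  connect (@adjacent s) x y -> crow x < crow y -> vertical (component x).
Proof.
move=> strip_s xy lt_xy.
have [e|[_ cx]] := strip_cells strip_s xy; first by rewrite e ltnn in lt_xy.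
rewrite /vertical cx /= (cardsD1 x) (cardsD1 y) !inE connect0 xy.
by have -> : y != x by apply: contraTneq lt_xy => ->; rewrite ltnn.
Qed.

(** Inside a component of a strip, a cell can only be above another one if the
    component is vertical, so there the first disjunct of [cdescent] is absorbed
    by the second. For distinct components, [crow_lt_component] applies to each. *)
Lemma cdescent_component s (x x' y y' : cell s) : is_strip s ->
    connect (@adjacent s) x x' -> connect (@adjacent s) y y' ->
  cdescent x y = cdescent x' y'.
Proof.
move=> strip_s xx' yy'; have sym := @connect_adjacent_sym s.
have eC : connect (@adjacent s) x y' = connect (@adjacent s) x y.
  by rewrite sym -(same_connect sym yy') sym.
rewrite /cdescent -(component_eq xx') !inE eC.
have [xy|nxy] /= := boolP (connect _ x y).
  have [//|nv] := boolP (vertical _); first by rewrite !orbT.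
  rewrite !orbF; transitivity false; last symmetry.
    by apply: contraNF nv; apply: vertical_component.
  apply: contraNF nv; rewrite (component_eq xx'); apply: vertical_component => //.
  by rewrite -(same_connect sym xx') eC.
rewrite !orbF (crow_lt_component xx' nxy).
have nyx' : ~~ connect (@adjacent s) y x' by rewrite sym -(same_connect sym xx').
have ny'x' : ~~ connect (@adjacent s) y' x' by rewrite -(same_connect sym yy').
have ney (u : cell s) : ~~ connect (@adjacent s) u x' -> crow u != crow x'.
  by apply: contra => /eqP /connect_same_row.
by have := crow_lt_component yy' nyx'; have := ney _ nyx'; have := ney _ ny'x'; lia.
Qed.

Lemma cdescent_gt1 s (x y : cell s) : cdescent x y -> 1 < ncells s.
Proof.
case/orP=> [lt_xy|/andP[_ /andP[_ h]]].
  rewrite /ncells (cardD1 x) (cardD1 y) !inE.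
  by have -> : y != x by apply: contraTneq lt_xy => ->; rewrite ltnn.
exact: leq_trans h (max_card _).
Qed.

(** * Tableaux of strip shape *)

Lemma SYT_inj s (T : SYT s) : injective T.
Proof. by have /andP[/andP[/injectiveP]] := tableau_standard T. Qed.

Lemma SYT_gt0 s (T : SYT s) x : 0 < T x.
Proof.
by have /andP[/andP[_ /forallP/(_ x)]] := tableau_standard T; rewrite inE.
Qed.

Lemma SYT_row s (T : SYT s) x y :
  crow x = crow y -> ccol x < ccol y -> T x < T y.
Proof.
have /and3P[_ /forallP/(_ x)/forallP/(_ y)/implyP h _] := tableau_standard T.
by move=> e lt; apply: h; rewrite e eqxx.
Qed.

Lemma SYT_column s (T : SYT s) x y :
  ccol x = ccol y -> crow x < crow y -> T x < T y.
Proof.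
have /and3P[_ _ /forallP/(_ x)/forallP/(_ y)/implyP h] := tableau_standard T.
by move=> e lt; apply: h; rewrite e eqxx.
Qed.

(** The cells of a component form a chain, and the sum of the two coordinates
    is a position along it that serves rows and columns alike. *)
Lemma SYT_component_lt s (T : SYT s) x y : is_strip s ->
    connect (@adjacent s) x y ->
  (T x < T y) = (crow x + ccol x < crow y + ccol y).
Proof.
move=> strip_s xy; case: (strip_cells strip_s xy) => [er|[ec _]].
  rewrite er ltn_add2l; case: (ltngtP (ccol x) (ccol y)) => [lt|lt|ec].
  - by rewrite (SYT_row T er).
  - by have := SYT_row T (esym er) lt; lia.
  - by rewrite (cell_inj er ec) ltnn.
rewrite ec ltn_add2r; case: (ltngtP (crow x) (crow y)) => [lt|lt|er].
- by rewrite (SYT_column T ec).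
- by have := SYT_column T (esym ec) lt; lia.
- by rewrite (cell_inj er ec) ltnn.
Qed.

(** Increasing columns exclude that the smaller of two entries of a vertical
    component is the lower one. *)
Lemma cdescent_standard s (T : SYT s) x y : is_strip s ->
  T x < T y -> cdescent x y = (crow x < crow y).
Proof.
move=> strip_s lt_xy; rewrite /cdescent.
have [//|le_yx] := ltnP (crow x) (crow y).
apply/negbTE/andP=> -[yx /andP[/forall_inP cx _]].
have /eqP ec : ccol x == ccol y.
  by have := cx x; rewrite inE connect0 => /(_ isT)/forall_inP/(_ y yx).
move: lt_xy; rewrite SYT_component_lt //; last by move: yx; rewrite inE.
by rewrite ec ltn_add2r ltnNge le_yx.
Qed.

(** Let k be the smallest entry placed differently, x its cell in T and x' its
    cell in T'. These cells lie in one component. If x' comes first in it, then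
    T has at x' an entry less than k, at which the tableaux agree; if x comes
    first, then T' has at x an entry less than k. Both are impossible. *)
Lemma SYT_component_perm_inj s (T T' : SYT s) (sigma : {perm cell s}) :
    is_strip s -> (forall z, connect (@adjacent s) z (sigma z)) ->
    (forall z, T' z = T (sigma z)) ->
  T = T'.
Proof.
move=> strip_s conn eT; suff H k x : T x < k -> T' x = T x.
  by apply/val_inj/ffunP=> x; rewrite /= (H (T x).+1).
elim: k x => // k IH x; rewrite ltnS leq_eqVlt => /orP[/eqP ex|/IH //].
have [x' ex'] : exists x', sigma x' = x.
  by exists ((sigma^-1)%g x); rewrite permKV.
have eT' : T' x' = T x by rewrite eT ex'.
have xx' : connect (@adjacent s) x x'.
  by rewrite connect_adjacent_sym -[in X in connect _ _ X]ex'.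
case: (ltngtP (T x) (T x')) => [lt|lt|/val_inj/SYT_inj exx'].
- have lt' : T (sigma x) < k.
    rewrite -eT -ex -eT' SYT_component_lt //.
    by rewrite SYT_component_lt in lt.
  by have := IH _ lt'; rewrite -eT => /SYT_inj fx; rewrite eT fx.
- by have := IH x'; rewrite -ex eT' => /(_ lt) e; rewrite e ltnn in lt.
- by rewrite eT [in sigma x]exx' ex'.
Qed.

(** * Promotion *)

(** Composing the switches gives a permutation of the cells, and each switch
    exchanges two adjacent cells. *)
Lemma jdt_component_perm s (F : filling s) (nF : numbering F) :
  exists sigma : {perm cell s}, (forall z, connect (@adjacent s) z (sigma z)) /\
    (forall z, jdt nF z = F (sigma z)).
Proof.
rewrite /jdt /=; elim: (ex_minn _) => [|k [sigma [conn eF]]].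
  by exists 1%g; split=> z; rewrite perm1.
rewrite iterS /jdt_step; case: pickP => [[x y] /=|_]; last by exists sigma.
case/and4P=> _ _ yx _; exists (tperm x y * sigma)%g.
split=> z; last by rewrite ffunE eF permM.
have xy : connect (@adjacent s) x y.
  by apply: connect1; rewrite /adjacent; case/orP: yx => ->; rewrite ?orbT.
rewrite permM; apply: connect_trans (conn _).
by case: tpermP => [->|->|_ _]; rewrite ?connect0 // connect_adjacent_sym.
Qed.

Lemma cyc_succE n (k : 'I_n.+1) : 0 < k ->
  cyc_succ k = (if k == n :> nat then 1 else k.+1) :> nat.
Proof. by move=> k_gt0; rewrite inordK //; have := ltn_ord k; case: eqP => /=; lia. Qed.

Lemma cyc_pred_gt0 n (k : 'I_n.+1) : 0 < k -> 0 < cyc_pred k.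
Proof. by rewrite cyc_predE; have := ltn_ord k; case: eqP => /=; lia. Qed.

Lemma cyc_succK n (k : 'I_n.+1) : 0 < k -> cyc_pred (cyc_succ k) = k.
Proof.
move=> k_gt0; apply/val_inj; rewrite /= cyc_predE cyc_succE //.
by have := ltn_ord k; do 2![case: eqP => /=]; lia.
Qed.

Lemma cyc_predK n (k : 'I_n.+1) : 0 < k -> cyc_succ (cyc_pred k) = k.
Proof.
move=> k_gt0; apply/val_inj; rewrite /= cyc_succE ?cyc_pred_gt0 // cyc_predE.
by have := ltn_ord k; do 2![case: eqP => /=]; lia.
Qed.

Lemma promotion_component_perm s (T : SYT s) :
  exists sigma : {perm cell s}, (forall z, connect (@adjacent s) z (sigma z)) /\
    (forall z, cyc_succ (promotion T z) = T (sigma z)).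
Proof.
have [sigma [conn e]] := jdt_component_perm
  (pred_filling_numbering (proj1 (andP (tableau_standard T)))).
exists sigma; split=> // z; rewrite -[RHS]cyc_predK ?SYT_gt0 //; congr cyc_succ.
by rewrite e ffunE.
Qed.

Lemma promotion_inj s : is_strip s -> injective (@promotion s).
Proof.
move=> strip_s T T' eT.
have [sigma [conn e]] := promotion_component_perm T.
have [sigma' [conn' e']] := promotion_component_perm T'.
apply: (@SYT_component_perm_inj _ _ _ (sigma'^-1 * sigma)%g) => // z.
  rewrite permM; apply: connect_trans (conn _).
  by rewrite connect_adjacent_sym -[in X in connect _ _ X](permKV sigma' z).
by rewrite permM -e eT e' permKV.
Qed.

(** * Cyclic descents *)

(** For i = n the successor is 1, so this reads the word of T cyclically. *)
Definition cyclic_descents s (T : SYT s) : {set 'I_(ncells s).+1} :=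
  [set i : 'I_(ncells s).+1 | (0 < i) &&
    [exists x, exists y, [&& T x == i, T y == cyc_succ i & cdescent x y]]].

Lemma cyclic_descentsP s (T : SYT s) (i : 'I_(ncells s).+1) :
  reflect (exists x y, [/\ T x = i, T y = cyc_succ i & cdescent x y])
          (i \in cyclic_descents T).
Proof.
rewrite inE; apply: (iffP andP) => [[_ /existsP[x /existsP[y /and3P[]]]]|].
  by move=> /eqP ex /eqP ey xy; exists x, y.
case=> x [y [ex ey xy]]; split; first by rewrite -ex SYT_gt0.
by apply/existsP; exists x; apply/existsP; exists y; rewrite ex ey !eqxx.
Qed.

Lemma mem_Des s (T : SYT s) (i : 'I_(ncells s).+1) : is_strip s ->
  (i \in Des T) = (i < ncells s) && (i \in cyclic_descents T).
Proof.
move=> strip_s; rewrite !inE.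
case i0: (0 < i); rewrite /= ?andbF //; case i1: (i < ncells s) => //=.
apply: eq_existsb => x; apply: eq_existsb => y.
have ->: (T y == cyc_succ i) = (T y == i.+1 :> nat).
  by rewrite -val_eqE /= cyc_succE // (ltn_eqF i1).
case: eqP => //= ex; case: eqP => //= ey.
by rewrite (cdescent_standard strip_s (T := T)) // ex ey.
Qed.

(** Promotion moves each entry i to i - 1 within the component of i. *)
Lemma rotate_promotion s (T : SYT s) : is_strip s ->
  rotate (cyclic_descents (promotion T)) = cyclic_descents T.
Proof.
move=> strip_s; have [sigma [conn e]] := promotion_component_perm T.
apply/setP=> i; apply/imsetP/cyclic_descentsP.
  case=> j /cyclic_descentsP[x [y [ex ey xy]]] ->.
  exists (sigma x), (sigma y); rewrite -!e ex ey.
  by rewrite -(cdescent_component strip_s (conn x) (conn y)).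
case=> x [y [ex ey xy]]; have i0 : 0 < i by rewrite -ex SYT_gt0.
exists (cyc_pred i); last by rewrite cyc_predK.
apply/cyclic_descentsP; exists ((sigma^-1)%g x), ((sigma^-1)%g y).
have eV z : promotion T ((sigma^-1)%g z) = cyc_pred (T z).
  by rewrite -[z in RHS](permKV sigma) -e cyc_succK ?SYT_gt0.
rewrite !eV ex ey cyc_predK // cyc_succK //; split=> //.
by rewrite (cdescent_component strip_s (conn _) (conn _)) !permKV.
Qed.

Lemma cyclic_descents_max s (T : SYT s) : is_strip s ->
  (ord_max \in cyclic_descents T) <->
  (n_north_of_1 T \/ same_vertical_component T).
Proof.
move=> strip_s; have sym := @connect_adjacent_sym s.
have succ_max : 0 < ncells s -> cyc_succ (@ord_max (ncells s)) = 1 :> nat.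
  by move=> n0; rewrite cyc_succE //= eqxx.
split=> [/cyclic_descentsP[x [y [ex ey /orP xy]]]|].
  have n0 : 0 < ncells s by have := SYT_gt0 T x; rewrite ex.
  case: xy => [lt_xy|/andP[yx vx]]; [left|right].
    apply/existsP; exists x; apply/existsP; exists y.
    by rewrite ex ey succ_max // !eqxx.
  apply/existsP; exists y; apply/existsP; exists x.
  rewrite ex ey succ_max // !eqxx /= -(component_eq (x := x)); last first.
    by move: yx; rewrite inE.
  by rewrite inE connect0.
have mem x y : T x = ncells s :> nat -> T y = 1 :> nat -> cdescent x y ->
    ord_max \in cyclic_descents T.
  move=> ex ey xy; apply/cyclic_descentsP; exists x, y; split=> //.
    exact/val_inj.
  by apply/val_inj; rewrite /= succ_max // -ex SYT_gt0.
case=> /existsP[x /existsP[y]]; last case/and4P=> /eqP ex /eqP ey yx vx.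
  by case/and3P=> /eqP ex /eqP ey xy; apply: (mem x y); rewrite // /cdescent xy.
move: (yx); rewrite inE => xy; apply: (mem y x) => //.
by rewrite /cdescent -(component_eq xy) vx inE connect0 orbT.
Qed.

Theorem proposition4p1 (s : skew_shape) (strip_s : is_strip s) :
  exists cDes : SYT s -> {set 'I_(ncells s).+1},
    [/\ cyclic_descent_map cDes,
        forall T : SYT s, (ord_max \in cDes T) <->
          (n_north_of_1 T \/ same_vertical_component T)
      & forall T : SYT s, (n_north_of_1 T \/ same_vertical_component T) <->
          (inord (ncells s).-1 \in Des (promotion T))].
Proof.
exists (@cyclic_descents s); split; first split.
- by move=> T; apply/subsetP=> i; rewrite !inE => /andP[].
- move=> T; apply/setP=> i; rewrite mem_Des // !inE andbC.
  by case: (0 < i); rewrite ?andbF.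
- have perm_p : perm_eq (map (@promotion s) (enum {: SYT s})) (enum {: SYT s}).
    apply: uniq_perm; rewrite ?enum_uniq //.
      by rewrite map_inj_uniq ?enum_uniq //; apply: promotion_inj.
    move=> T; rewrite mem_enum; apply/mapP.
    have [g _ Kg] := injF_bij (promotion_inj strip_s).
    by exists (g T); rewrite ?mem_enum ?Kg.
  rewrite perm_sym; have := perm_map (fun T => rotate (cyclic_descents T)) perm_p.
  by rewrite -map_comp (eq_map (fun T => rotate_promotion T strip_s)).
- by move=> T; apply: cyclic_descents_max.
move=> T; apply: (iff_trans (iff_sym (cyclic_descents_max T strip_s))).
(* For n <= 1 there is no n - 1 in [n], and no cyclic descent either. *)
have [n_gt1|n_le1] := ltnP 1 (ncells s); last first.
  split=> [/cyclic_descentsP[x [y [_ _ /cdescent_gt1]]]|]; first by lia.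
  by rewrite inE inordK //; lia.
(* Otherwise n - 1 < n, so n - 1 is a cyclic descent of the promoted tableau
   exactly when it is a descent. *)
have pred_max : inord (ncells s).-1 = cyc_pred (@ord_max (ncells s)).
  by apply/val_inj; rewrite /= cyc_predE (gtn_eqF n_gt1) inordK //; lia.
rewrite pred_max mem_Des // -(rotate_promotion T strip_s) cyc_predE /=.
rewrite (gtn_eqF n_gt1) ltn_predL (ltnW n_gt1) /=.
split=> [/imsetP[j j_in e]|j_in].
  by rewrite e cyc_succK //; move: j_in; rewrite inE => /andP[].
by apply/imsetP; exists (cyc_pred ord_max) => //; rewrite cyc_predK //= ltnW.
Qed.
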